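(* Let $C$ be an $n$-dimensional centrally symmetric convex body in $\mathbb{E}^n$ (centered at the origin $\mathbf{o}$), let $\Lambda$ be an $n$-dimensional lattice in $\mathbb{E}^n$, and let $\gamma$ denote the smallest positive number such that $\gamma C+\Lambda$ is a covering of $\mathbb{E}^n$. If the boundary $\partial(C)$ contains no (nondegenerate) segment parallel to any of the vectors $\mathbf{v}\in 2\gamma C\cap(\Lambda\setminus\{\mathbf{o}\})$, then $M(C,\Lambda)$ is a centrally symmetric star body and $M(C,\Lambda)+\Lambda$ is a tiling of $\mathbb{E}^n$.
   Context: $\mathbb{E}^n$ is $n$-dimensional Euclidean space with inner product $\langle\cdot,\cdot\rangle$ and origin $\mathbf{o}$. A centrally symmetric convex body is a compact convex set $C$ with nonempty interior and $C=-C$; it defines the norm $\|\mathbf{x}\|_C=\min\{\lambda\ge 0:\mathbf{x}\in\lambda C\}$, and $\|\mathbf{x},\mathbf{y}\|_C=\|\mathbf{y}-\mathbf{x}\|_C$. For distinct points $\mathbf{p},\mathbf{q}$ let $H(\mathbf{p},\mathbf{q})=\{\mathbf{y}:\langle\mathbf{y},\mathbf{q}-\mathbf{p}\rangle=0\}$, and for $\mathbf{x}\in H(\mathbf{p},\mathbf{q})$ let $S(C,\mathbf{p},\mathbf{q},\mathbf{x})$ be the set of points $\mathbf{y}$ on the line $\{\mathbf{x}+\lambda(\mathbf{q}-\mathbf{p}):\lambda\in\mathbb{R}\}$ with $\|\mathbf{p},\mathbf{y}\|_C=\|\mathbf{q},\mathbf{y}\|_C$. It is known that this set is always a single point or a closed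 segment; let $\overline{\mathbf{x}}$ denote its midpoint. Define $$D(C,\mathbf{p},\mathbf{q})=\{\overline{\mathbf{x}}+\lambda(\mathbf{q}-\mathbf{p}):\mathbf{x}\in H(\mathbf{p},\mathbf{q}),\ \lambda\le 0\}.$$ For a lattice $\Lambda$ the Minkowski cell is $$M(C,\Lambda)=\bigcap_{\mathbf{v}\in\Lambda\setminus\{\mathbf{o}\}}D(C,\mathbf{o},\mathbf{v}).$$ An $n$-dimensional lattice is a discrete subgroup of $\mathbb{E}^n$ of rank $n$. $\gamma C+\Lambda$ is a covering of $\mathbb{E}^n$ if $\bigcup_{\mathbf{v}\in\Lambda}(\gamma C+\mathbf{v})=\mathbb{E}^n$. A centrally symmetric star body is a compact set $M$ with $M=-M$ that is star-shaped with respect to $\mathbf{o}$ (i.e. $\mathbf{u}\in M$ and $0\le\alpha\le1$ imply $\alpha\mathbf{u}\in M$). $M+\Lambda$ is a tiling if $\bigcup_{\mathbf{v}\in\Lambda}(M+\mathbf{v})=\mathbb{E}^n$ and the interiors of $M+\mathbf{v}$ and $M+\mathbf{w}$ are disjoint for distinct $\mathbf{v},\mathbf{w}\in\Lambda$. *)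

(* Defs.v *)
From mathcomp Require Import all_boot all_order all_algebra.
From mathcomp Require Import all_classical all_reals all_analysis.
Set Implicit Arguments.
Unset Strict Implicit.
Unset Printing Implicit Defensive.
Import Order.TTheory GRing.Theory Num.Theory.
Import numFieldNormedType.Exports.
Local Open Scope classical_set_scope.
Local Open Scope ring_scope.

(* E^n is 'rV[R]_n with R : realType. The library topology on 'rV[R]_n is the
   product one, that is, the Euclidean topology. *)

Definition dot (R : realType) (n : nat) (x y : 'rV[R]_n) : R :=
  (x *m y^T) 0 0.

Definition scale_set (R : realType) (n : nat) (l : R) (A : set 'rV[R]_n) :
    set 'rV[R]_n :=
  [set l *: x | x in A].

Definition translate (R : realType) (n : nat) (A : set 'rV[R]_n)
    (v : 'rV[R]_n) : set 'rV[R]_n :=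
  [set x + v | x in A].

Definition segment (R : realType) (n : nat) (a b : 'rV[R]_n) : set 'rV[R]_n :=
  [set a + t *: (b - a) | t in `[0, 1]].

Definition boundary (R : realType) (n : nat) (A : set 'rV[R]_n) :
    set 'rV[R]_n :=
  closure A `\` interior A.

Definition centrally_symmetric (R : realType) (n : nat) (A : set 'rV[R]_n) :
    Prop :=
  A = [set - x | x in A].

Definition cs_convex_body (R : realType) (n : nat) (C : set 'rV[R]_n) : Prop :=
  [/\ compact C, convex_set (C : set (convex_lmodType 'rV[R]_n)),
      interior C !=set0 & centrally_symmetric C].

(* For a centrally symmetric convex body the set below is nonempty and closed,
   so that its infimum is its minimum. *)
Definition body_norm (R : realType) (n : nat) (C : set 'rV[R]_n)
    (x : 'rV[R]_n) : R :=
  inf [set l : R | 0 <= l /\ scale_set l C x].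

Definition body_dist (R : realType) (n : nat) (C : set 'rV[R]_n)
    (x y : 'rV[R]_n) : R :=
  body_norm C (y - x).

Definition hyperplane (R : realType) (n : nat) (p q : 'rV[R]_n) :
    set 'rV[R]_n :=
  [set y | dot y (q - p) = 0].

Definition equidistant_on_line (R : realType) (n : nat) (C : set 'rV[R]_n)
    (p q x : 'rV[R]_n) : set 'rV[R]_n :=
  [set y | (exists l : R, y = x + l *: (q - p)) /\
           body_dist C p y = body_dist C q y].

(* The case a = b covers single points. *)
Definition is_midpoint (R : realType) (n : nat) (A : set 'rV[R]_n)
    (m : 'rV[R]_n) : Prop :=
  exists a b, A = segment a b /\ m = 2^-1 *: (a + b).

(* The midpoint [xbar] is given relationally: for a centrally symmetric convex
   body C and p != q, [equidistant_on_line C p q x] is always a (possibly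
   degenerate) closed segment, so exactly one [xbar] qualifies for each x. *)
Definition half_space (R : realType) (n : nat) (C : set 'rV[R]_n)
    (p q : 'rV[R]_n) : set 'rV[R]_n :=
  [set z | exists x xbar (l : R),
    [/\ hyperplane p q x, is_midpoint (equidistant_on_line C p q x) xbar,
        l <= 0 & z = xbar + l *: (q - p)]].

Definition minkowski_cell (R : realType) (n : nat) (C L : set 'rV[R]_n) :
    set 'rV[R]_n :=
  \bigcap_(v in L `\ 0) half_space C 0 v.

Definition Z_independent (V : zmodType) (r : nat) (b : 'I_r -> V) : Prop :=
  forall z : 'I_r -> int, \sum_(i < r) b i *~ z i = 0 -> forall i, z i = 0.

(* Rank of a subgroup L as an abelian group. *)
Definition has_rank (V : zmodType) (L : set V) (r : nat) : Prop :=
  (exists b : 'I_r -> V, (forall i, L (b i)) /\ Z_independent b) /\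
  (forall b : 'I_r.+1 -> V, (forall i, L (b i)) -> ~ Z_independent b).

Definition is_lattice (R : realType) (n : nat) (L : set 'rV[R]_n) : Prop :=
  [/\ L 0, (forall u v, L u -> L v -> L (u - v)), L `<=` isolated L &
      has_rank L n].

Definition is_covering (R : realType) (n : nat) (A L : set 'rV[R]_n) : Prop :=
  \bigcup_(v in L) translate A v = setT.

Definition smallest_covering_factor (R : realType) (n : nat)
    (C L : set 'rV[R]_n) (g : R) : Prop :=
  [/\ 0 < g, is_covering (scale_set g C) L &
      forall h : R, 0 < h -> is_covering (scale_set h C) L -> g <= h].

Definition contains_segment_parallel_to (R : realType) (n : nat)
    (A : set 'rV[R]_n) (v : 'rV[R]_n) : Prop :=
  exists a b, [/\ a != b, segment a b `<=` A & exists t : R, b - a = t *: v].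

Definition cs_star_body (R : realType) (n : nat) (M : set 'rV[R]_n) : Prop :=
  [/\ compact M, centrally_symmetric M &
      forall u (a : R), M u -> 0 <= a <= 1 -> M (a *: u)].

Definition is_tiling (R : realType) (n : nat) (M L : set 'rV[R]_n) : Prop :=
  is_covering M L /\
  forall v w, L v -> L w -> v != w ->
    interior (translate M v) `&` interior (translate M w) = set0.

(* Main.v *)
Require Import Defs.
From mathcomp Require Import all_boot all_order all_algebra.
From mathcomp Require Import all_classical all_reals all_analysis.
From mathcomp Require Import ring lra.
Set Implicit Arguments.
Unset Strict Implicit.
Unset Printing Implicit Defensive.
Import Order.TTheory GRing.Theory Num.Theory.
Import numFieldNormedType.Exports.
Local Open Scope classical_set_scope.
Local Open Scope ring_scope.

(** The half-spaces in the definition of the cell are awkward because of the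
midpoints of the equidistant segments: such a midpoint need not depend
continuously on the line that carries the segment. The key point is that the
cell is nevertheless the Voronoi cell of the origin for the norm of C, that is,
the set of the z with |z| <= |z - v| for all v in L.

On a line with direction v, the function s |-> |x + s v| is convex, so its
increments over intervals of length 1 are nondecreasing. Hence the difference
|y| - |y - v|, called [gap] below, is nondecreasing along the line; it changes
sign, and its zero set is a compact interval ([gap_line_zeros]). Therefore the
half-space of v lies between {|z| < |z - v|} and {|z| <= |z - v|}
([half_space_of_norm_lt], [half_space_norm_le]). If the gap vanishes at two
points of a line, convexity makes the norm constant on a segment of that line
with endpoints that differ by v, and a homothetic copy of this segment lies on
the boundary of C ([boundary_segment_of_two_zeros]). So the half-space of v is
exactly {|z| <= |z - v|} when the boundary has no segment parallel to v.

The points of the Voronoi cell have norm at most gamma, because every point is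
within gamma of L. For |v| > 2 gamma the triangle inequality then gives
|z| < |z - v| on the Voronoi cell, so v imposes no constraint, whatever the
shape of its half-space; for |v| <= 2 gamma the hypothesis on segments applies.
This identifies the two cells ([minkowski_cellE]).

For the Voronoi cell the conclusions are direct. It is closed, and contained in
the compact set gamma C; symmetry and star-shapedness follow from the norm
axioms. Every point has a nearest lattice point, which gives the covering. If
the interiors of two translates met, the gap for the difference u of the
lattice points would vanish on an open set, hence at two points of a line of
direction u, and |u| <= 2 gamma; the boundary of C would contain a forbidden
segment. *)

(** * Convex functions on the real line *)

(** Convexity, written without division so that degenerate intervals need no
separate treatment. *)
Definition below_chords (R : realType) (g : R -> R) : Prop :=
  forall a b c, a <= b -> b <= c ->
    (c - a) * g b <= (c - b) * g a + (b - a) * g c.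

(** Both s and t - 1 lie in [s - 1, t], at positions symmetric to each other;
adding the two chord inequalities for that interval gives the claim. *)
Lemma unit_increment_nondecreasing (R : realType) (g : R -> R) (s t : R) :
  below_chords g -> s <= t -> g s - g (s - 1) <= g t - g (t - 1).
Proof.
move=> cvx st.
have h1 := cvx (s - 1) s t ltac:(lra) st.
have h2 := cvx (s - 1) (t - 1) t ltac:(lra) ltac:(lra).
rewrite -subr_ge0 -(pmulr_rge0 _ (_ : 0 < t - s + 1)); last by lra.
lra.
Qed.

(** Convexity forces the values at s - 1, s, t - 1 and t to agree. On [s - 1, s]
g is then at most g s by convexity, and at least g s because a smaller value
there would force g s < g t. *)
Lemma constant_of_two_zero_increments (R : realType) (g : R -> R) (s t : R) :
  below_chords g -> s < t -> g s = g (s - 1) -> g t = g (t - 1) ->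
  forall r, s - 1 <= r <= s -> g r = g s.
Proof.
move=> cvx st gs gt r /andP[r1 r2].
have h1 := cvx (s - 1) s t ltac:(lra) ltac:(lra).
have h2 := cvx (s - 1) (t - 1) t ltac:(lra) ltac:(lra).
have h3 := cvx (s - 1) r s r1 r2.
have h4 := cvx r s t r2 (ltW st).
have k3 : g t = g s.
  (* s and t - 1 both lie between s - 1 and t. *)
  rewrite -gs -gt in h1 h2.
  apply/eqP; rewrite eq_le; apply/andP; split.
    by rewrite -subr_ge0; nra.
  rewrite -subr_ge0 -(pmulr_rge0 _ (_ : 0 < t - s)); nra.
rewrite -gs k3 in h3 h4.
apply/eqP; rewrite eq_le; apply/andP; split.
  rewrite -subr_ge0; nra.
rewrite -subr_ge0 -(pmulr_rge0 _ (_ : 0 < t - s)); nra.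
Qed.

(** * Norms on a line *)

Definition is_norm (R : realType) (V : lmodType R) (N : V -> R) : Prop :=
  [/\ forall x y, N (x + y) <= N x + N y,
      forall a x, N (a *: x) = `|a| * N x &
      forall x, N x = 0 -> x = 0].

(** Its sign tells which of the sites 0 and v is nearer to y. *)
Definition gap (R : realType) (V : lmodType R) (N : V -> R) (v y : V) : R :=
  N y - N (y - v).

Section NormOnLine.
Context (R : realType) (V : lmodType R) (N : V -> R).
Context (norm_N : is_norm N).

Lemma norm0 : N 0 = 0.
Proof.
by case: norm_N => _ homN _; rewrite -(scale0r 0) homN normr0 mul0r.
Qed.

Lemma normN x : N (- x) = N x.
Proof.
by case: norm_N => _ homN _; rewrite -scaleN1r homN normrN1 mul1r.
Qed.

Lemma norm_ge0 x : 0 <= N x.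
Proof.
case: norm_N => triN _ _; have := triN x (- x).
by rewrite subrr norm0 normN; lra.
Qed.

Lemma norm_gt0 x : x != 0 -> 0 < N x.
Proof.
case: norm_N => _ _ defN /eqP x0; rewrite lt_neqAle norm_ge0 andbT eq_sym.
by apply/eqP => /defN.
Qed.

Lemma normB_ge x y : N x - N y <= N (x - y).
Proof.
by case: norm_N => triN _ _; have := triN (x - y) y; rewrite subrK; lra.
Qed.

Lemma norm_line_convex x v : below_chords (fun r : R => N (x + r *: v)).
Proof.
move=> a b c ab bc; case: norm_N => triN homN _.
have homp s y : 0 <= s -> N (s *: y) = s * N y.
  by move=> s0; rewrite homN ger0_norm.
rewrite -!homp ?subr_ge0 ?(le_trans ab bc)//.
apply: le_trans (triN _ _); rewrite le_eqVlt; apply/orP; left; apply/eqP.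
congr N; rewrite !scalerDr !scalerA addrACA -!scalerDl.
by congr (_ *: _ + _ *: _); ring.
Qed.

Lemma gap_lineE x v (s : R) :
  gap N v (x + s *: v) = N (x + s *: v) - N (x + (s - 1) *: v).
Proof. by rewrite /gap scalerBl scale1r addrA. Qed.

Lemma gap_line_nondecreasing x v (s t : R) : s <= t ->
  gap N v (x + s *: v) <= gap N v (x + t *: v).
Proof.
move=> st; rewrite !gap_lineE.
exact: (unit_increment_nondecreasing (norm_line_convex x v)).
Qed.

Lemma norm_line_flat x v (s t : R) : s < t ->
  gap N v (x + s *: v) = 0 -> gap N v (x + t *: v) = 0 ->
  forall r, s - 1 <= r <= s -> N (x + r *: v) = N (x + s *: v).
Proof.
rewrite !gap_lineE => st /subr0_eq gs /subr0_eq gt.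
exact: (constant_of_two_zero_increments (norm_line_convex x v) st).
Qed.

(** The hypothesis makes the norm at x + s v larger than at x; a convex function
increases from then on. *)
Lemma gap_line_gt0 x v (s : R) : 1 < s -> 2 * N x < s * N v ->
  0 < gap N v (x + s *: v).
Proof.
move=> s1 big; rewrite gap_lineE subr_gt0.
have := @norm_line_convex x v 0 (s - 1) s; rewrite scale0r addr0.
have : s * N v - N x <= N (x + s *: v).
  have := normB_ge (s *: v) (- x); rewrite opprK normN [_ + x]addrC.
  case: norm_N => _ homN _; rewrite homN gtr0_norm //.
  exact: lt_trans ltr01 s1.
move: (N (x + s *: v)) (N (x + (s - 1) *: v)) => B A far.
move=> /(_ ltac:(lra) ltac:(lra)) cvx.
have e : s - (s - 1) = 1 by ring.
rewrite e mul1r !subr0 in cvx.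
rewrite ltNge; apply/negP => BA.
suff : B <= N x by lra.
by nra.
Qed.

(** The point reflection in v / 2 exchanges the two sites; it turns a bound
for large s into one for very negative s. *)
Lemma gap_line_opp x v (s : R) :
  gap N v (x + s *: v) = - gap N v (- x + (1 - s) *: v).
Proof.
rewrite !gap_lineE opprB -[in RHS]normN -[in X in _ = _ - X]normN !opprD opprK.
rewrite -!scaleNr; congr (N (_ + _ *: _) - N (_ + _ *: _)); ring.
Qed.

Lemma norm_line_lipschitz x v (s t : R) :
  `|N (x + s *: v) - N (x + t *: v)| <= `|s - t| * N v.
Proof.
case: norm_N => _ homN _; rewrite -homN scalerBl ler_norml.
rewrite [X in N X](_ : _ = (x + s *: v) - (x + t *: v)); last first.
  by rewrite opprD addrACA subrr add0r.
rewrite normB_ge andbT -normN opprB lerNl opprB; exact: normB_ge.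
Qed.

Lemma gap_line_continuous x v : continuous (fun s : R => gap N v (x + s *: v)).
Proof.
move=> s; apply/cvgrPdist_le => e e0.
have M0 : 0 < 2 * N v + 1 by have := norm_ge0 v; lra.
near=> t.
rewrite !gap_lineE.
have h1 := norm_line_lipschitz x v s t.
have h2 := norm_line_lipschitz x v (s - 1) (t - 1).
have st : `|s - t| <= e / (2 * N v + 1).
  near: t; apply: (@cvgr_dist_le _ _ _ _ _ id); first exact: cvg_id.
  by rewrite divr_gt0.
rewrite ler_pdivlMr// in st.
have eB : s - 1 - (t - 1) = s - t by ring.
rewrite eB in h2.
rewrite opprB addrA.
set a := N _; set b := N (x + (s - 1) *: v) in h2 *.
rewrite (_ : a - b + N (x + (t - 1) *: v) - N (x + t *: v) =
  (a - N (x + t *: v)) - (b - N (x + (t - 1) *: v))); last by ring.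
apply: le_trans (ler_normB _ _) _.
have := normr_ge0 (s - t); rewrite -/a in h1; nra.
Unshelve. all: by end_near.
Qed.

(** The zero set of a nondecreasing continuous function that is negative near
-oo and positive near +oo. *)
Lemma gap_line_zeros x v : v != 0 -> exists a b : R,
  a <= b /\ forall s, gap N v (x + s *: v) = 0 <-> a <= s <= b.
Proof.
move=> v0; set f := fun s => gap N v (x + s *: v).
have Nv := norm_gt0 v0.
(* Chosen so that gap_line_gt0 applies at m, for x and for - x. *)
pose m := 2 + 2 * N x / N v.
have xv : 0 <= 2 * N x / N v.
  by rewrite divr_ge0 ?norm_ge0// mulr_ge0// norm_ge0.
have mNv : 2 * N x < m * N v.
  by rewrite /m [ltRHS]mulrDl mulfVK ?gt_eqF//; lra.
have fm : 0 < f m by apply: gap_line_gt0; rewrite // /m; lra.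
have fm' : f (1 - m) < 0.
  rewrite /f gap_line_opp oppr_lt0 subKr.
  by apply: gap_line_gt0; rewrite ?normN// /m; lra.
have fmono s t : s <= t -> f s <= f t by exact: gap_line_nondecreasing.
have fcont := @gap_line_continuous x v.
pose Z := [set s | f s = 0].
have Zbnd s : Z s -> 1 - m <= s <= m.
  rewrite /Z/= => fs.
  apply/andP; split; rewrite leNgt; apply/negP => /ltW/fmono.
    by rewrite fs; lra.
  by rewrite fs; lra.
have Z0 : Z !=set0.
  have [| | |c _ fc] := @IVT R f (1 - m) m 0.
  - by rewrite /m; lra.
  - exact: continuous_subspaceT.
  - by rewrite ge_min le_max (ltW fm) (ltW fm') orbT.
  - by exists c.
have Zcl : closed Z.
  apply: (@preimage_closed _ _ f [set 0]); last exact: closed_eq.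
  by move=> s _; exact: fcont.
have Zcomp : compact Z.
  apply: (subclosed_compact Zcl (@segment_compact _ (1 - m) m)) => s /Zbnd.
  by rewrite /= in_itv.
have idc : {within Z, continuous (id : R -> R)}.
  by apply: continuous_subspaceT => y.
have [a /set_mem Za aP] := compact_EVT_min Z0 Zcomp idc.
have [b /set_mem Zb bP] := compact_EVT_max Z0 Zcomp idc.
exists a, b; split=> [|s]; first by apply: aP; rewrite inE.
split=> [fs|/andP[/fmono h1 /fmono h2]].
  by rewrite aP ?bP// inE.
by apply/eqP; rewrite eq_le -{1}Zb h2 -Za h1.
Qed.

End NormOnLine.

(** * The norm of a symmetric convex body *)

Section BodyNorm.
Context (R : realType) (n : nat) (C : set 'rV[R]_n).
Context (hC : cs_convex_body C).
Local Notation N := (body_norm C).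

Lemma body_opp x : C x -> C (- x).
Proof. by case: hC => _ _ _ symC Cx; rewrite symC; exists x. Qed.

Lemma body_mix (t : R) x y : 0 <= t <= 1 -> C x -> C y ->
  C (t *: x + (1 - t) *: y).
Proof.
case: hC => _ cvxC _ _ /andP[t0 t1] Cx Cy.
have := cvxC x y (Itv01 t0 t1); rewrite !inE => /(_ Cx Cy).
by rewrite /conv/=; rewrite /unstable.onem.
Qed.

(** The midpoint of z + 2 x and - z is x, so a ball around an interior point z
moves to a ball around 0. *)
Lemma body_near0 : exists2 r : R, 0 < r & forall x, `|x| < r -> C x.
Proof.
case: hC => _ _ [z /nbhs_ballP[r /= r0 zrC]] _.
exists (r / 2); first by rewrite divr_gt0.
move=> x xr.
have Cz : C (- z) by apply/body_opp/zrC/ballxx.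
have Czx : C (z + 2 *: x).
  apply: zrC; rewrite -ball_normE /= opprD addrA subrr sub0r normrN normrZ.
  by rewrite gtr0_norm// mulrC -ltr_pdivlMr.
have := @body_mix 2^-1 _ _ _ Czx Cz.
rewrite (_ : 1 - 2^-1 = 2^-1); last by lra.
rewrite -scalerDr addrAC subrr add0r scalerA mulVf// scale1r.
by apply; lra.
Qed.

Lemma body_shrink (t : R) x : 0 <= t <= 1 -> C x -> C (t *: x).
Proof.
move=> t01 Cx; have [r r0 rC] := body_near0.
have := @body_mix t x 0 t01 Cx; rewrite scaler0 addr0; apply.
by apply: rC; rewrite normr0.
Qed.

Lemma scale_set_le (l m : R) x : 0 <= l -> l <= m ->
  scale_set l C x -> scale_set m C x.
Proof.
move=> l0 lm [y Cy <-]; have [m0|m0] := eqVneq m 0.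
  by exists y => //; congr (_ *: _); lra.
have mp : 0 < m by rewrite lt_neqAle eq_sym m0 (le_trans l0).
exists ((l / m) *: y); last by rewrite scalerA mulrC mulfVK.
apply: body_shrink => //; apply/andP; split; first by rewrite divr_ge0// ltW.
by rewrite ler_pdivrMr// mul1r.
Qed.

Lemma scale_set_absorbing : exists2 K : R, 0 < K &
  forall x, scale_set (K * `|x|) C x.
Proof.
have [r r0 rC] := body_near0.
have K0 : 0 < 2 / r by rewrite divr_gt0.
exists (2 / r) => // x.
have [->|x0] := eqVneq x 0.
  exists 0; last by rewrite scaler0.
  by apply: rC; rewrite normr0.
have Kx : 0 < 2 / r * `|x| by rewrite mulr_gt0// normr_gt0.
exists ((2 / r * `|x|)^-1 *: x); last first.
  by rewrite scalerA mulfV ?gt_eqF// scale1r.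
apply: rC; rewrite normrZ gtr0_norm ?invr_gt0//.
rewrite invfM -mulrA mulVf ?normr_eq0// mulr1 invf_div.
by rewrite ltr_pdivrMr// ltr_pMr//; lra.
Qed.

Lemma body_norm_has_inf x : has_inf [set l : R | 0 <= l /\ scale_set l C x].
Proof.
have [K K0 KC] := scale_set_absorbing.
split; last by exists 0 => l [].
by exists (K * `|x|); split; rewrite ?mulr_ge0// ltW.
Qed.

Lemma body_norm_ge0 x : 0 <= N x.
Proof. by apply: lb_le_inf => [|l []//]; case: (body_norm_has_inf x). Qed.

Lemma body_norm_le (l : R) x : 0 <= l -> scale_set l C x -> N x <= l.
Proof. by move=> l0 lx; apply: ge_inf; [case: (body_norm_has_inf x)|]. Qed.

Lemma scale_set_compact (l : R) : compact (scale_set l C).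
Proof.
case: hC => compC _ _ _; apply: continuous_compact => //.
by apply: continuous_subspaceT; exact: scaler_continuous.
Qed.

Lemma scale_set_closed (l : R) : closed (scale_set l C).
Proof.
by apply: compact_closed; [exact: norm_hausdorff|exact: scale_set_compact].
Qed.

(** The infimum in the norm is attained: x is at distance 0 from l C, since it
belongs to (l + d) C for all small d > 0 and C is bounded, and l C is closed. *)
Lemma scale_set_body_norm (l : R) x : N x <= l -> scale_set l C x.
Proof.
move=> xl; have l0 := le_trans (body_norm_ge0 x) xl.
rewrite ((closure_id _).1 (@scale_set_closed l)) => B /nbhs_ballP[e /= e0 eB].
have [compC _ _ _] := hC.
have [M [_ /(_ (`|M| + 1))]] := compact_bounded compC.
move=> /(_ ltac:(by rewrite (le_lt_trans (ler_norm _))// ltrDl)) /= CM.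
have M0 : 0 < `|M| + 1 by rewrite ltr_wpDl.
set b := _ + 1 in CM M0.
(* (l + d) z and l z differ by less than e when |z| <= b and d = e / (2 b). *)
have d0 : 0 < e / (2 * b) by rewrite divr_gt0// mulr_gt0.
have [m [m0 [y Cy yx]]] := inf_adherent d0 (body_norm_has_inf x).
rewrite -/(N x) => mx.
have /(scale_set_le m0) : m <= l + e / (2 * b) by lra.
move=> /(_ x ltac:(by exists y)) [z Cz zx].
exists (l *: z); split; first by exists z.
apply: eB; rewrite -ball_normE /= -zx -scalerBl addrAC subrr add0r.
rewrite normrZ gtr0_norm//.
apply: (@le_lt_trans _ _ (e / (2 * b) * b)).
  by apply: ler_wpM2l; [exact: ltW|exact: CM].
rewrite invfM mulrA mulfVK ?gt_eqF//; lra.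
Qed.

Lemma body_norm_is_norm : is_norm N.
Proof.
have scale_le (a : R) x : N (a *: x) <= `|a| * N x.
  apply: body_norm_le; first by rewrite mulr_ge0// body_norm_ge0.
  have [y Cy xE] := scale_set_body_norm (lexx (N x)).
  rewrite -{2}xE scalerA; have [a0|a0] := leP 0 a.
    by exists y; rewrite ?ger0_norm.
  exists (- y); first exact: body_opp.
  by rewrite ltr0_norm// scalerN -scaleNr mulNr opprK.
split.
- move=> x y; apply: body_norm_le; first by rewrite addr_ge0 ?body_norm_ge0.
  have [x' Cx xE] := scale_set_body_norm (lexx (N x)).
  have [y' Cy yE] := scale_set_body_norm (lexx (N y)).
  move: (N x) (N y) (body_norm_ge0 x) (body_norm_ge0 y) xE yE.
  move=> a b a0 b0 <- <-.
  have [ab0|ab0] := eqVneq (a + b) 0.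
    have [-> ->] : a = 0 /\ b = 0 by lra.
    by exists x' => //; rewrite !scale0r addr0 scale0r addr0.
  have abp : 0 < a + b by rewrite lt_neqAle eq_sym ab0 addr_ge0.
  (* a x + b y is a + b times a convex combination of x and y. *)
  exists ((a / (a + b)) *: x' + (1 - a / (a + b)) *: y').
    apply: body_mix => //.
    by rewrite ler_pdivrMr// divr_ge0//=; lra.
  rewrite scalerDr !scalerA; congr (_ *: _ + _ *: _); field => //.
- move=> a x; apply/eqP; rewrite eq_le scale_le /=.
  have [->|a0] := eqVneq a 0; first by rewrite normr0 mul0r body_norm_ge0.
  rewrite -{1}(scale1r x) -(mulVf a0) -scalerA.
  rewrite -ler_pdivlMl ?normr_gt0// -normfV; exact: scale_le.
- move=> x x0; have [|y _ <-] := @scale_set_body_norm 0 x; first by rewrite x0.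
  by rewrite scale0r.
Qed.

Lemma body_norm_continuous : continuous N.
Proof.
have [K K0 KC] := scale_set_absorbing.
have le x : N x <= K * `|x| by apply: body_norm_le; rewrite ?mulr_ge0// ltW.
move=> x; apply/(@cvgrPdist_le _ _ _ (nbhs x) (nbhs_filter x)) => e e0.
apply/nbhs_ballP; exists (K^-1 * e) => /=; first by rewrite mulr_gt0// invr_gt0.
move=> y; rewrite -ball_normE /= => /ltW xy.
apply: (@le_trans _ _ (K * `|x - y|)).
  rewrite ler_norml; apply/andP; split.
    rewrite lerNl opprB distrC; apply: le_trans (le _).
    exact: (normB_ge body_norm_is_norm).
  by apply: le_trans (le _); exact: (normB_ge body_norm_is_norm).
by rewrite -ler_pdivlMl.
Qed.

(** Around an interior point of C there is room to stretch by some 1 + t > 1,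
so its norm is less than 1. *)
Lemma body_norm1_boundary x : N x = 1 -> boundary C x.
Proof.
move=> x1; have Cx : C x.
  have [y Cy <-] : scale_set 1 C x by apply: scale_set_body_norm; rewrite x1.
  by rewrite scale1r.
split; first exact: subset_closure.
have [_ homN _] := body_norm_is_norm.
move=> xC.
have : \forall t \near (0 : R), C (x + t *: x).
  have cont : (fun t : R => x + t *: x) @ (0 : R) --> x.
    rewrite -[in X in _ --> X](addr0 x) -[X in _ + X](scale0r x).
    apply: cvgD; first exact: cvg_cst.
    exact: scalel_continuous.
  exact: cont xC.
move=> /nbhs_ballP[e /= e0 /(_ (e / 2))].
rewrite -ball_normE /= sub0r normrN gtr0_norm ?divr_gt0// => /(_ ltac:(lra)) h.
have xE : x + (e / 2) *: x = (1 + e / 2) *: x by rewrite scalerDl scale1r.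
have : scale_set 1 C ((1 + e / 2) *: x).
  by exists (x + (e / 2) *: x); rewrite ?scale1r.
by move=> /(body_norm_le ler01); rewrite homN x1 gtr0_norm; lra.
Qed.

End BodyNorm.

(** * Half-spaces and the comparison of distances *)

Section HalfSpace.
Context (R : realType) (n : nat) (C : set 'rV[R]_n).
Context (hC : cs_convex_body C).
Local Notation N := (body_norm C).
Local Notation normC := (body_norm_is_norm hC).

Lemma equidistant_on_line0E v x y : equidistant_on_line C 0 v x y <->
  (exists s : R, y = x + s *: v) /\ gap N v y = 0.
Proof.
rewrite /equidistant_on_line /body_dist /gap /= !subr0.
by split=> -[? /eqP yE]; split => //; apply/eqP; rewrite ?subr_eq0// -subr_eq0.
Qed.

Lemma equidistant_on_line_segment v x : v != 0 -> exists a b : R,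
  [/\ a <= b, forall s, gap N v (x + s *: v) = 0 <-> a <= s <= b &
    equidistant_on_line C 0 v x = segment (x + a *: v) (x + b *: v)].
Proof.
move=> v0; have [a [b [ab abP]]] := gap_line_zeros normC x v0.
exists a, b; split=> //; apply/seteqP; split=> y.
  move=> /equidistant_on_line0E[[s ->] /abP/andP[sa sb]].
  have [ab0|ba0] := eqVneq a b.
    exists 0; first by rewrite /= in_itv /= lexx ler01.
    by rewrite scale0r addr0; congr (_ + _ *: _); lra.
  have ba : 0 < b - a by rewrite subr_gt0 lt_neqAle ba0.
  exists ((s - a) / (b - a)).
    by rewrite /= in_itv /= ler_pdivrMr// divr_ge0 ?(ltW ba)//=; lra.
  rewrite opprD addrACA subrr add0r -scalerBl scalerA divfK ?gt_eqF//.
  by rewrite -addrA -scalerDl; congr (_ + _ *: _); ring.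
move=> [t /=]; rewrite in_itv /= => /andP[t0 t1] <-.
have -> : x + a *: v + t *: (x + b *: v - (x + a *: v)) =
    x + (a + t * (b - a)) *: v.
  by rewrite opprD addrACA subrr add0r -scalerBl scalerA -addrA -scalerDl.
apply/equidistant_on_line0E; split; first by eexists.
apply/abP; apply/andP; split; nra.
Qed.

(** The midpoint is equidistant because the equidistant set is convex, and the
gap is monotone along v. *)
Lemma half_space_norm_le v z : half_space C 0 v z -> N z <= N (z - v).
Proof.
move=> [x [m [s [_ [a [b [eqE ->]]] s0 ->]]]].
set m' := 2^-1 *: (a + b); rewrite subr0 in eqE *.
have : equidistant_on_line C 0 v x m'.
  rewrite eqE; exists 2^-1; first by rewrite /= in_itv /=; lra.
  rewrite scalerBr /m' scalerDr addrCA addrC; congr (_ + _).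
  by rewrite -{1}(scale1r a) -scalerBl; congr (_ *: _); lra.
move=> /equidistant_on_line0E[_ m0].
have := gap_line_nondecreasing normC m' v s0.
by rewrite scale0r addr0 m0 /gap subr_le0.
Qed.

Lemma dot_gt0 (v : 'rV[R]_n) : v != 0 -> 0 < dot v v.
Proof.
move=> v0; rewrite /dot mxE lt_neqAle eq_sym sumr_ge0 ?andbT; last first.
  by move=> i _; rewrite mxE -expr2 sqr_ge0.
apply: contra v0; rewrite psumr_eq0; last first.
  by move=> i _; rewrite mxE -expr2 sqr_ge0.
move=> /allP vE; apply/eqP/rowP => i; rewrite mxE; apply/eqP.
by have := vE i (mem_index_enum _); rewrite mxE mulf_eq0 orbb.
Qed.

(** By the last hypothesis z lies below the equidistant segment of its line or
is the lower end of it, hence is not above the midpoint. *)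
Lemma half_space_of_last_zero v z : v != 0 -> N z <= N (z - v) ->
  (forall s : R, s < 0 -> gap N v (z + s *: v) != 0) -> half_space C 0 v z.
Proof.
move=> v0 zle last; have vv := dot_gt0 v0.
(* x is the orthogonal projection of z to the hyperplane. *)
pose k := dot z v / dot v v; pose x := z - k *: v.
have zE : z = x + k *: v by rewrite subrK.
have [a [b [ab abP eqE]]] := equidistant_on_line_segment x v0.
exists x, (x + ((a + b) / 2) *: v), (k - (a + b) / 2); split.
- rewrite /hyperplane /= subr0 /x /dot mulmxBl -scalemxAl !mxE.
  move: vv; rewrite /k /dot !mxE => vv.
  by rewrite mulfVK ?gt_eqF// subrr.
- exists (x + a *: v), (x + b *: v); split=> //.
  rewrite addrACA -scalerDl -mulr2n scalerDr scalerA.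
  rewrite -[x *+ 2]scaler_nat scalerA.
  by rewrite mulVf// scale1r mulrC.
- rewrite leNgt; apply/negP => kab.
  have ak : a - k < 0 by lra.
  have /eqP[] := last _ ak.
  rewrite zE -addrA -scalerDl [k + _]addrC subrK.
  by apply/abP; rewrite lexx.
- by rewrite subr0 -addrA -scalerDl [_ + (k - _)]addrC subrK.
Qed.

Lemma half_space_of_norm_lt v z : v != 0 -> N z < N (z - v) ->
  half_space C 0 v z.
Proof.
move=> v0 zlt; apply: half_space_of_last_zero => // [|s s0]; first exact: ltW.
rewrite lt_eqF//; apply: (@le_lt_trans _ _ (gap N v (z + 0 *: v))).
  by apply: (gap_line_nondecreasing normC); exact: ltW.
by rewrite scale0r addr0 /gap subr_lt0.
Qed.

(** The norm is constant on the segment from x + (s - 1) v to x + s v; dividing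
by this constant moves the segment to the unit sphere. *)
Lemma boundary_segment_of_two_zeros v x (s t : R) : v != 0 -> s < t ->
  gap N v (x + s *: v) = 0 -> gap N v (x + t *: v) = 0 ->
  contains_segment_parallel_to (boundary C) v.
Proof.
move=> v0 st gs gt; have [_ homN defN] := normC.
have flat := norm_line_flat normC st gs gt.
set m := N (x + s *: v) in flat.
have diff : x + s *: v - (x + (s - 1) *: v) = v.
  rewrite opprD addrACA subrr add0r -scalerBl (_ : s - (s - 1) = 1) ?scale1r//.
  by ring.
have m0 : 0 < m.
  rewrite lt_neqAle body_norm_ge0// andbT eq_sym; apply: contra v0 => /eqP mz.
  have := flat (s - 1) ltac:(lra); rewrite mz => /defN e1.
  by move: diff; rewrite e1 (defN _ mz) subrr => <-.
have vE : m^-1 *: (x + s *: v) - m^-1 *: (x + (s - 1) *: v) = m^-1 *: v.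
  by rewrite -scalerBr diff.
exists (m^-1 *: (x + (s - 1) *: v)), (m^-1 *: (x + s *: v)); split.
- rewrite eq_sym -subr_eq0 vE scaler_eq0 negb_or v0 andbT.
  by rewrite invr_eq0 gt_eqF.
- move=> y [r /=]; rewrite in_itv /= => r01 <-.
  apply: body_norm1_boundary => //.
  rewrite vE scalerA mulrC -scalerA -scalerDr -addrA -scalerDl homN.
  rewrite flat; last by lra.
  by rewrite gtr0_norm ?invr_gt0// mulVf ?gt_eqF.
- by exists m^-1.
Qed.

Lemma half_space_of_norm_le v z : v != 0 ->
  ~ contains_segment_parallel_to (boundary C) v ->
  N z <= N (z - v) -> half_space C 0 v z.
Proof.
move=> v0 noseg zle; apply: half_space_of_last_zero => // s s0.
apply/eqP => gs; apply: noseg.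
apply: (@boundary_segment_of_two_zeros v z s 0) => //.
apply/le_anti/andP; split; first by rewrite scale0r addr0 /gap subr_le0.
by rewrite -[leLHS]gs; apply: (gap_line_nondecreasing normC); exact: ltW.
Qed.

End HalfSpace.

(** * Lattices *)

Lemma lattice_opp (R : realType) (n : nat) (L : set 'rV[R]_n) v :
  is_lattice L -> L v -> L (- v).
Proof. by case=> L0 LB _ _ Lv; rewrite -sub0r; exact: LB. Qed.

Lemma lattice_add (R : realType) (n : nat) (L : set 'rV[R]_n) v w :
  is_lattice L -> L v -> L w -> L (v + w).
Proof.
move=> latL Lv Lw; case: (latL) => _ LB _ _; rewrite -(opprK w).
by apply: LB => //; exact: lattice_opp.
Qed.

(** Lattice points at a mutual distance less than the isolation radius e of 0
coincide, so at most one of them is within e / 2 of a limit point y. *)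
Lemma lattice_closed (R : realType) (n : nat) (L : set 'rV[R]_n) :
  is_lattice L -> closed L.
Proof.
move=> [L0 LB isoL _] y clLy.
have [_ [V /nbhs_ballP[e /= e0 eV] VL]] := isoL 0 L0.
have only0 u : L u -> `|u| < e -> u = 0.
  move=> Lu ue; suff : (V `&` L) u by rewrite VL.
  by split => //; apply: eV; rewrite -ball_normE /= sub0r normrN.
have e20 : 0 < e / 2 by rewrite divr_gt0.
have [v [Lv]] := clLy _ (nbhsx_ballx y _ e20).
rewrite -ball_normE /= => yv.
have [->//|yv0] := eqVneq y v.
have yv_gt0 : 0 < `|y - v| by rewrite normr_gt0 subr_eq0.
have [w [Lw]] := clLy _ (nbhsx_ballx y _ yv_gt0).
rewrite -ball_normE /= => yw.
suff wv : w - v = 0.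
  by move: yw; rewrite (subr0_eq wv) ltxx.
apply: only0; first exact: LB.
rewrite -(subrKA y) (le_lt_trans (ler_normD _ _))// [`|w - y|]distrC.
by move: yw yv; lra.
Qed.

(** * The Voronoi cell and the Minkowski cell *)

Section Cell.
Context (R : realType) (n : nat) (C L : set 'rV[R]_n) (gamma : R).
Context (hC : cs_convex_body C).
Context (hL : is_lattice L).
Local Notation N := (body_norm C).
Local Notation normC := (body_norm_is_norm hC).

Definition voronoi_cell : set 'rV[R]_n :=
  [set z | forall v, L v -> N z <= N (z - v)].

(** Only lattice points at distance at most |z| from z compete with 0, and they
form a compact set. *)
Lemma nearest_lattice_point z :
  exists2 v, L v & forall w, L w -> N (z - v) <= N (z - w).
Proof.
pose B := [set w : 'rV[R]_n | N (z - w) <= N z].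
have cont_sub : continuous (fun w : 'rV[R]_n => z - w).
  move=> w; apply: (@cvgB _ _ _ _ (nbhs_filter w)); last exact: cvg_id.
  by apply: cvg_cst; exact: nbhs_filter.
have contN : continuous (fun w : 'rV[R]_n => N (z - w)).
  move=> w; apply: (@continuous_cvg _ _ _ _ (nbhs_filter w) _ N).
    exact: (body_norm_continuous hC).
  exact: cont_sub.
have compB : compact B.
  have -> : B = [set z - x | x in scale_set (N z) C].
    apply/seteqP; split=> w /=.
      by exists (z - w); [exact: scale_set_body_norm|rewrite subKr].
    move=> [x zx <-]; rewrite /B /= subKr.
    by apply: body_norm_le => //; exact: body_norm_ge0.
  apply: continuous_compact; last exact: scale_set_compact.
  exact: continuous_subspaceT.
have compLB : compact (B `&` L).
  by apply: compact_closedI => //; exact: lattice_closed.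
have LB0 : B `&` L !=set0.
  by exists 0; split; [rewrite /B /= subr0|case: hL].
have [v] := compact_EVT_min LB0 compLB (continuous_subspaceT contN).
rewrite inE => -[Bv Lv] vmin; exists v => // w Lw.
have [wB|wB] := leP (N (z - w)) (N z).
  by apply: vmin; rewrite inE.
exact: le_trans Bv (ltW wB).
Qed.

Lemma closed_voronoi_cell : closed voronoi_cell.
Proof.
have -> : voronoi_cell = \bigcap_(v in L) (gap N v @^-1` [set s | s <= 0]).
  by apply/seteqP; split=> z zP v Lv; have := zP v Lv; rewrite /= /gap subr_le0.
apply: closed_bigI => v Lv; apply: preimage_closed; last exact: closed_le.
move=> z _; apply: (@cvgB _ _ _ _ (nbhs_filter z)).
  exact: (body_norm_continuous hC).
apply: (@continuous_cvg _ _ _ _ (nbhs_filter z) _ N).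
  exact: (body_norm_continuous hC).
apply: (@cvgB _ _ _ _ (nbhs_filter z)); first exact: cvg_id.
by apply: cvg_cst; exact: nbhs_filter.
Qed.

Lemma voronoi_cell_opp z : voronoi_cell z -> voronoi_cell (- z).
Proof.
move=> zP v Lv; rewrite (normN normC) -(normN normC (- z - v)) opprD opprK.
by apply: zP; exact: lattice_opp.
Qed.

(** |z - v| <= (1 - a) |z| + |a z - v| and |z| <= |z - v|. *)
Lemma voronoi_cell_star z (a : R) :
  voronoi_cell z -> 0 <= a <= 1 -> voronoi_cell (a *: z).
Proof.
move=> zP /andP[a0 a1] v Lv; have [triN homN _] := normC.
have : N (z - v) <= (1 - a) * N z + N (a *: z - v).
  rewrite -[X in X * _](ger0_norm (_ : 0 <= 1 - a)) ?subr_ge0// -homN.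
  apply: le_trans (triN _ _); rewrite addrA -scalerDl subrK scale1r.
  exact: lexx.
have := zP _ Lv; rewrite homN ger0_norm//; lra.
Qed.

Lemma voronoi_cell_covering : is_covering voronoi_cell L.
Proof.
apply/seteqP; split=> // z _; have [v Lv vmin] := nearest_lattice_point z.
exists v => //; exists (z - v); last by rewrite subrK.
by move=> w Lw; rewrite -addrA -opprD; apply: vmin; exact: lattice_add.
Qed.

Context (gamma_cover : is_covering (scale_set gamma C) L).
Context (gamma_gt0 : 0 < gamma).

Lemma covering_distance z : exists2 v, L v & N (z - v) <= gamma.
Proof.
have : [set: 'rV[R]_n] z by []; rewrite -gamma_cover => -[v Lv [x xC <-]].
by exists v => //; rewrite addrK; apply: body_norm_le => //; exact: ltW.
Qed.

(** A lattice point within gamma of z is at least as far from z as 0 is. *)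
Lemma voronoi_cell_norm_le z : voronoi_cell z -> N z <= gamma.
Proof.
by move=> zV; have [v Lv] := covering_distance z; apply: le_trans; exact: zV.
Qed.

Lemma compact_voronoi_cell : compact voronoi_cell.
Proof.
apply: (@subclosed_compact _ _ (scale_set gamma C)).
- exact: closed_voronoi_cell.
- exact: scale_set_compact.
by move=> z /voronoi_cell_norm_le; exact: scale_set_body_norm.
Qed.

Context (no_parallel_segment :
  forall v : 'rV[R]_n, (scale_set (2 * gamma) C `&` (L `\ 0)) v ->
     ~ contains_segment_parallel_to (boundary C) v).

(** Only the v with |v| <= 2 gamma matter for the Voronoi cell, and for these
the half-space is {|z| <= |z - v|}. *)
Lemma minkowski_cellE : minkowski_cell C L = voronoi_cell.
Proof.
apply/seteqP; split=> z zP.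
  move=> v Lv; have [->|v0] := eqVneq v 0; first by rewrite subr0.
  by apply: (half_space_norm_le hC); apply: zP; split=> //; exact/eqP.
move=> v [Lv /eqP v0].
have [near|far] := leP (N v) (2 * gamma).
  apply: (half_space_of_norm_le hC) => //; last exact: zP.
  apply: no_parallel_segment; split; last by split=> //; exact/eqP.
  exact: scale_set_body_norm.
apply: (half_space_of_norm_lt hC) => //.
have := voronoi_cell_norm_le zP; have := normB_ge normC v z.
by rewrite -(normN normC (v - z)) opprB; lra.
Qed.

(** A common interior point z gives an open set of points y such that y - v is
equidistant from 0 and u = w - v, in particular two of them on a line with
direction u. *)
Lemma voronoi_cell_interiors_disjoint v w : L v -> L w -> v != w ->
  interior (translate voronoi_cell v) `&` interior (translate voronoi_cell w)
    = set0.
Proof.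
move=> Lv Lw vw; apply/seteqP; split=> // z [zv zw].
pose u := w - v.
have Lu : L u by case: hL => _ LB _ _; exact: LB.
have u0 : u != 0 by rewrite subr_eq0 eq_sym.
have cell_v y : translate voronoi_cell v y -> voronoi_cell (y - v).
  by move=> [x xV <-]; rewrite addrK.
have cell_w y : translate voronoi_cell w y -> voronoi_cell (y - v - u).
  by move=> [x xV <-]; rewrite /u opprB addrA subrK addrK.
have zero y : translate voronoi_cell v y -> translate voronoi_cell w y ->
    gap N u (y - v) = 0.
  move=> /cell_v yv /cell_w yw; apply/eqP; rewrite subr_eq0 eq_le yv//=.
  have := yw _ (lattice_opp hL Lu); rewrite opprK subrK; exact.
have : \forall t \near (0 : R), translate voronoi_cell v (z + t *: u) /\
    translate voronoi_cell w (z + t *: u).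
  have cont : (fun t : R => z + t *: u) @ (0 : R) --> z.
    rewrite -[in X in _ --> X](addr0 z) -[X in _ + X](scale0r u).
    apply: cvgD; first exact: cvg_cst.
    exact: scalel_continuous.
  by apply: filterI; exact: cont.
move=> /nbhs_ballP[e /= e0 eP].
have /eP[ev ew] : ball (0 : R) e (e / 2).
  by rewrite -ball_normE /= sub0r normrN gtr0_norm; lra.
have /eP[ov ow] := ballxx (0 : R) e0.
have e20 : 0 < e / 2 by rewrite divr_gt0.
apply: (@no_parallel_segment u).
  split; last by split=> //; exact/eqP.
  apply: (scale_set_body_norm hC).
  have := voronoi_cell_norm_le (cell_v _ ov).
  have := voronoi_cell_norm_le (cell_w _ ow).
  have := normB_ge normC u (z + 0 *: u - v).
  by rewrite -[N (u - _)](normN normC) opprB; lra.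
apply: (@boundary_segment_of_two_zeros _ _ _ hC u (z - v) 0 (e / 2)) => //.
  by have := zero _ ov ow; rewrite addrAC.
by have := zero _ ev ew; rewrite addrAC.
Qed.

End Cell.

Theorem theorem4 (R : realType) (n : nat) (C L : set 'rV[R]_n) (gamma : R)
  (hC : cs_convex_body C)
  (hL : is_lattice L)
  (hgamma : smallest_covering_factor C L gamma)
  (hseg : forall v : 'rV[R]_n, (scale_set (2 * gamma) C `&` (L `\ 0)) v ->
     ~ contains_segment_parallel_to (boundary C) v) :
  cs_star_body (minkowski_cell C L) /\ is_tiling (minkowski_cell C L) L.
Proof.
have [gamma0 cover _] := hgamma.
rewrite (minkowski_cellE hC cover gamma0 hseg).
split; split.
- exact: compact_voronoi_cell cover gamma0.
- apply/seteqP; split=> z.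
    by move=> /(voronoi_cell_opp hC hL); exists (- z); rewrite ?opprK.
  by move=> [x /(voronoi_cell_opp hC hL) ? <-].
- by move=> u a uV; exact: voronoi_cell_star.
- exact: voronoi_cell_covering.
- move=> v w.
  exact: (voronoi_cell_interiors_disjoint hC hL cover gamma0 hseg).
Qed.
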